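(* Let $d\ge 1$ and $m>n\ge 1$ be integers, and let $f(d,n,m)$ be the minimum number of sets in an antipodal $(n,m)$-fold cover of $S^d$ with open sets. Then \[\left\lceil \tfrac{d-1}{2}\right\rceil+n+m \le f(d,n,m)\le d+n+m.\]
   Context: $S^d$ denotes the $d$-dimensional unit sphere in $\mathbb{R}^{d+1}$ centered at the origin. A cover of $S^d$ is a (finite) family of subsets of $S^d$; it is an $n$-fold cover if every point of $S^d$ belongs to at least $n$ of the sets. A cover is antipodal if none of its sets contains a pair of antipodal points $x,-x$. The open northern hemisphere is $\{x\in S^d: x_{d+1}>0\}$. For $m>n\ge 1$, an $(n,m)$-fold cover of $S^d$ is an $n$-fold cover of $S^d$ in which every point of the open northern hemisphere belongs to at least $m$ of the sets. *)

(* Defs.v *)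
From HB Require Import structures.
From mathcomp Require Import all_boot all_order all_algebra.
From mathcomp Require Import all_classical all_reals all_analysis.
From mathcomp Require Import Rstruct Rstruct_topology.
Set Implicit Arguments. Unset Strict Implicit. Unset Printing Implicit Defensive.
Import Order.TTheory GRing.Theory Num.Theory.
Local Open Scope classical_set_scope.
Local Open Scope ring_scope.

(* Points of R^(d+1) are row vectors 'rV[R]_(d.+1) (product topology = Euclidean). *)
Definition pt (d : nat) := 'rV[Rdefinitions.R]_(d.+1).

Definition unit_sphere (d : nat) : set (pt d) :=
  [set x | \sum_(i < d.+1) (x ord0 i) ^+ 2 = 1].
Arguments unit_sphere d : clear implicits.

Definition north_hemi (d : nat) : set (pt d) :=
  [set x | x \in unit_sphere d /\ 0 < x ord0 ord_max].
Arguments north_hemi d : clear implicits.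

Definition open_in_sphere (d : nat) (A : set (pt d)) : Prop :=
  exists U : set (pt d), open U /\ A = U `&` unit_sphere d.

Definition mult (d k : nat) (F : 'I_k -> set (pt d)) (x : pt d) : nat :=
  #|[set i : 'I_k | x \in F i]|.

Definition antipodal_nm_open_cover (d n m k : nat) (F : 'I_k -> set (pt d)) : Prop :=
  [/\ forall i, open_in_sphere (F i),
      forall i x, x \in F i -> (- x) \notin F i,
      forall x, x \in unit_sphere d -> (n <= mult F x)%N &
      forall x, x \in north_hemi d -> (m <= mult F x)%N].

(* Main.v *)
Require Import Defs.
From mathcomp Require Import all_boot all_order all_algebra.
From mathcomp Require Import all_classical all_reals all_analysis.
From mathcomp Require Import Rstruct Rstruct_topology.
From mathcomp Require Import ring lra zify.
Set Implicit Arguments. Unset Strict Implicit. Unset Printing Implicit Defensive.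
Import Order.TTheory GRing.Theory Num.Theory.
Import numFieldNormedType.Exports.

(** Upper bound: by Gale's lemma the vectors (-1)^i (1, i, ..., i^d), i < d + 2n,
    have at least n members in every open hemisphere, so the d + 2n open hemispheres
    they define form an antipodal n-fold cover; add m - n copies of the northern
    hemisphere.

    Lower bound: triangulate the sphere finely and symmetrically, so that (Lebesgue
    number) around each vertex v at least n sets contain a whole small ball.  Label
    a northern v with + and the n-th smallest index of these sets, and a southern v
    with - and the index attached to -v.  As the sets are antipodal, nearby vertices
    never get opposite labels, so by Ky Fan's lemma some small simplex has d + 1
    vertices whose labels have increasing indices and alternating signs.  This simplex
    straddles the equator.  Its majority sign occurs floor(d/2) + 1 times (say it is
    +): the first such vertex accounts for n sets of index at most its label, the
    others for floor(d/2) sets of larger index, and all of these contain a common ball.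
    That ball contains a southern point y, and the m sets covering -y are other sets,
    hence k >= n + floor(d/2) + m. *)

(** * Chains modulo 2 *)

Section Chains.
Variable T : eqType.
Implicit Types (f : seq T -> bool) (t : seq T) (C : seq (seq T)).

(* A mod-2 chain is a list of vertex tuples, observed only through its sums
   against F_2-valued functions [f] of tuples. *)
Definition chain_sum f C : bool := \big[addb/false]_(t <- C) f t.

Fixpoint faces t : seq (seq T) :=
  if t is x :: s then s :: map (cons x) (faces s) else [::].

Definition boundary C := flatten (map faces C).

Lemma chain_sum_flatten f (g : seq T -> seq (seq T)) C :
  chain_sum f (flatten (map g C)) = chain_sum (fun t => chain_sum f (g t)) C.
Proof. by rewrite /chain_sum big_flatten big_map. Qed.

Lemma chain_sum_cat f C D :
  chain_sum f (C ++ D) = chain_sum f C (+) chain_sum f D.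
Proof. by rewrite /chain_sum big_cat. Qed.

Lemma chain_sum_cons f t C : chain_sum f (t :: C) = f t (+) chain_sum f C.
Proof. by rewrite /chain_sum big_cons. Qed.

Lemma chain_sumD f g C :
  chain_sum (fun t => f t (+) g t) C = chain_sum f C (+) chain_sum g C.
Proof. by rewrite /chain_sum big_split. Qed.

Lemma eq_chain_sum f g C :
  (forall t, t \in C -> f t = g t) -> chain_sum f C = chain_sum g C.
Proof. by move=> fg; apply: eq_big_seq. Qed.

Lemma mem_faces w t : w \in faces t ->
  size t = (size w).+1 /\ {subset w <= t}.
Proof.
elim: t w => [|x s IH] w //=; rewrite inE => /orP[/eqP-> | /mapP[u /IH[-> us] ->]].
  by split=> // y; rewrite inE orbC => ->.
by split=> // y; rewrite !inE => /orP[->//|/us->]; rewrite orbT.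
Qed.
End Chains.

Lemma chain_sum_map (T U : eqType) (f : seq T -> bool) (h : seq U -> seq T) C :
  chain_sum f (map h C) = chain_sum (f \o h) C.
Proof. by rewrite /chain_sum big_map. Qed.

Lemma faces_map (T U : eqType) (h : U -> T) t :
  faces (map h t) = map (map h) (faces t).
Proof. by elim: t => //= x s ->; rewrite -!map_comp. Qed.

Section Boundary.
Variable T : eqType.
Implicit Types (f : seq T -> bool) (t : seq T) (C : seq (seq T)).

Lemma chain_sum_faces_cons f x s :
  chain_sum f (faces (x :: s)) = f s (+) chain_sum (f \o cons x) (faces s).
Proof. by rewrite /= chain_sum_cons chain_sum_map. Qed.

(** The cone formula. A one-vertex tuple has the empty tuple as its face, so dimension 0 is no
    exception. *)
Lemma boundary_cone f x C :
  chain_sum f (boundary (map (cons x) C)) =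
  chain_sum f C (+) chain_sum (f \o cons x) (boundary C).
Proof.
rewrite /boundary -map_comp !chain_sum_flatten -chain_sumD.
by apply: eq_bigr => s _; rewrite -chain_sum_faces_cons.
Qed.

(** By the cone formula for [x :: s], the faces of [s] occur twice and cancel mod 2. *)
Lemma boundary_faces f t : chain_sum f (boundary (faces t)) = false.
Proof.
elim: t f => [|x s IH] f; first by rewrite /chain_sum big_nil.
rewrite /boundary /= chain_sum_cat -/(boundary _) boundary_cone IH addbF.
exact: addbb.
Qed.

(** A symmetric [f] cannot see which of several equal entries is deleted. In this form the sum
    visibly does not depend on the order of [t]. *)
Lemma chain_sum_faces_rem f t : (forall u v, perm_eq u v -> f u = f v) ->
  chain_sum f (faces t) = \big[addb/false]_(x <- t) f (rem x t).
Proof.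
elim: t f => [|x s IH] f fP; first by rewrite /chain_sum !big_nil.
rewrite chain_sum_faces_cons IH; last first.
  by move=> u v uv; apply: fP; rewrite perm_cons.
rewrite big_cons /= eqxx; congr (_ (+) _).
apply: eq_big_seq => y ys /=; case: eqP => // xy.
by rewrite xy; apply: fP; rewrite perm_sym perm_to_rem.
Qed.

Lemma chain_sum_faces_perm f t u : (forall u v, perm_eq u v -> f u = f v) ->
  perm_eq t u -> chain_sum f (faces t) = chain_sum f (faces u).
Proof.
move=> fP tu; rewrite !chain_sum_faces_rem // (perm_big _ tu) /=.
apply: eq_big_seq => x xu; apply: fP; rewrite -(perm_cons x).
have xt : x \in t by rewrite (perm_mem tu).
rewrite -(permPl (perm_to_rem xt)); exact: perm_trans tu (perm_to_rem xu).
Qed.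
End Boundary.

(** * Ky Fan's lemma *)

Section Alternation.

Fixpoint alternating (b : bool) (s : bitseq) : bool :=
  if s is c :: s' then (c == b) && alternating (~~ b) s' else true.

(** A word alternating from either sign has exactly one face alternating from [b], got by deleting
    an end letter. In any other word, a deletion that leaves an alternating word removes one of two
    equal neighbours, so such deletions come in pairs. *)
Lemma alternating_faces b s : s != [::] ->
  chain_sum (alternating b) (faces s) = alternating true s (+) alternating false s.
Proof.
elim: s b => // c s IH b _; rewrite chain_sum_faces_cons.
have -> : chain_sum (alternating b \o cons c) (faces s) =
  (c == b) && chain_sum (alternating (~~ b)) (faces s).
  by rewrite /chain_sum big_distrr.
case: s IH => [|c' s] IH; first by rewrite /chain_sum big_nil; case: c b => [] [].
rewrite IH //; move: (c' :: s) => u; case: c b {IH} => [] [] /=;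
by case: (alternating true u); case: (alternating false u).
Qed.

Lemma alternating_negb b s : alternating b (map negb s) = alternating (~~ b) s.
Proof. by elim: s b => //= c s IH b; rewrite IH; case: c b => [] []. Qed.

(* A label c encodes a sign, its parity, and an index, c./2. *)
Definition sorted_alternating (b : bool) (s : seq nat) : bool :=
  alternating b (map odd (sort leq s)).

Lemma sorted_alternating_perm b s t :
  perm_eq s t -> sorted_alternating b s = sorted_alternating b t.
Proof.
by move=> st; congr (alternating _ (map _ _)); apply/perm_sortP => //;
  [exact: leq_total|exact: leq_trans|exact: anti_leq].
Qed.

Lemma sorted_alternating_faces b s : s != [::] ->
  chain_sum (sorted_alternating b) (faces s) =
  sorted_alternating true s (+) sorted_alternating false s.
Proof.
move=> s0; have st : perm_eq s (sort leq s) by rewrite perm_sym perm_sort.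
rewrite (chain_sum_faces_perm (@sorted_alternating_perm b) st).
rewrite -(alternating_faces b); last by rewrite -size_eq0 size_map size_sort size_eq0.
rewrite faces_map chain_sum_map; apply: eq_chain_sum => t tf.
rewrite /sorted_alternating /=; congr (alternating _ (map _ _)).
apply: sorted_sort; first exact: leq_trans.
apply: (subseq_sorted leq_trans) (sort_sorted leq_total s).
elim: (sort leq s) t tf => //= x u IH t.
rewrite inE => /orP[/eqP-> | /mapP[v /IH vu ->]]; first exact: subseq_cons.
by rewrite /= eqxx.
Qed.

(** The sign change on labels: it exchanges 2j and 2j+1 and so keeps the index. *)
Definition flip (c : nat) : nat := if odd c then c.-1 else c.+1.

Lemma odd_flip c : odd (flip c) = ~~ odd c.
Proof. by case: c => // c; rewrite /flip (fun_if odd) /=; case: (odd c). Qed.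

(** [flip] moves a label by one, so it can reverse the order only within a pair 2j, 2j+1. The
    hypothesis excludes such pairs, hence sorting commutes with [flip]. *)
Lemma sorted_alternating_flip b s :
  {in s &, forall c c', c != flip c'} ->
  sorted_alternating b (map flip s) = sorted_alternating (~~ b) s.
Proof.
move=> nc; rewrite /sorted_alternating -alternating_negb -map_comp.
rewrite -(eq_map (odd_flip : odd \o flip =1 negb \o odd)) map_comp.
congr (alternating _ (map _ _)).
have -> : sort leq [seq flip i | i <- s] = sort leq [seq flip i | i <- sort leq s].
  apply/perm_sortP; [exact: leq_total|exact: leq_trans|exact: anti_leq|].
  by rewrite perm_map // perm_sym perm_sort.
apply: sorted_sort; first exact: leq_trans.
rewrite sorted_map; apply: (sub_in_sorted (P := mem s) _ _ (sort_sorted leq_total s)); last first.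
  by apply/allP => x; rewrite mem_sort.
move=> x y xs ys; rewrite leq_eqVlt => /orP[/eqP->|xy]; first exact: leqnn.
rewrite /= /flip; move: (nc y x ys xs); rewrite /flip.
case: ifP => ox; case: ifP => oy yx.
- by rewrite -!subn1 leq_sub2r // ltnW.
- by rewrite (leq_trans (leq_pred _)) // ltnW // ltnW.
- by case: y xy yx {ys oy} => // y; rewrite ltnS eqSS ltn_neqAle eq_sym => -> ->.
- by rewrite ltnS ltnW.
Qed.
End Alternation.

Local Open Scope ring_scope.

(** * Barycentric subdivision *)

Section Subdivision.
Variables (R : realFieldType) (V : lmodType R).
Implicit Types (f : seq V -> bool) (t : seq V) (C : seq (seq V)).

Definition barycenter t : V := ((size t)%:R : R)^-1 *: \sum_(x <- t) x.

Definition antipode t : seq V := map -%R t.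

Fixpoint subdiv (n : nat) t : seq (seq V) :=
  if n is n'.+1 then
    map (cons (barycenter t)) (flatten (map (subdiv n') (faces t)))
  else [:: t].

Definition subdiv_chain n C := flatten (map (subdiv n) C).

Lemma size_mem_subdiv n t u : size t = n -> u \in subdiv n t -> size u = n.
Proof.
elim: n t u => [|n IH] t u tn; first by rewrite inE => /eqP->.
case/mapP => v /flatten_mapP[w /mem_faces[+ _] vw] ->.
by rewrite tn => -[/esym/IH/(_ vw)] /= ->.
Qed.

(** The cone formula leaves the subdivided facets and a cone over their boundary; by induction that
    boundary is the subdivision of the boundary of a boundary, which vanishes. *)
Lemma boundary_subdiv f n t : size t = n.+1 ->
  chain_sum f (boundary (subdiv n.+1 t)) = chain_sum f (subdiv_chain n (faces t)).
Proof.
elim: n f t => [|n IH] f t tn; rewrite boundary_cone.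
  case: t tn => // x [|] //= _.
  by rewrite /chain_sum /boundary /= !big_nil addbF.
set g := f \o _; suff -> : chain_sum g (boundary (subdiv_chain n.+1 (faces t))) = false.
  by rewrite addbF.
have -> : chain_sum g (boundary (subdiv_chain n.+1 (faces t))) =
    chain_sum (fun w => chain_sum g (boundary (subdiv n.+1 w))) (faces t).
  rewrite /subdiv_chain /boundary map_flatten -map_comp.
  elim: (faces t) => [|w C IHC]; first by rewrite /chain_sum !big_nil.
  by rewrite /= !flatten_cat chain_sum_cat IHC chain_sum_cons.
rewrite -[RHS](boundary_faces (fun z => chain_sum g (subdiv n z)) t).
rewrite chain_sum_flatten; apply: eq_chain_sum => w /mem_faces[+ _].
by rewrite tn => -[/esym/(IH g)] ->; rewrite chain_sum_flatten.
Qed.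

Lemma boundary_subdiv_chain f n C : (forall t, t \in C -> size t = n.+1) ->
  chain_sum f (boundary (subdiv_chain n.+1 C)) =
  chain_sum f (subdiv_chain n (boundary C)).
Proof.
elim: C => [|t C IH] CP; first by rewrite /chain_sum !big_nil.
rewrite /subdiv_chain /boundary /= !map_cat !flatten_cat !chain_sum_cat.
rewrite -/(boundary _) -/(subdiv_chain _ _) IH; last first.
  by move=> u uC; apply: CP; rewrite inE uC orbT.
by rewrite boundary_subdiv // CP // mem_head.
Qed.

Lemma barycenter_antipode t : barycenter (antipode t) = - barycenter t.
Proof.
by rewrite /barycenter /antipode size_map big_map sumrN scalerN.
Qed.

Lemma subdiv_antipode n t : subdiv n (antipode t) = map antipode (subdiv n t).
Proof.
elim: n t => //= n IH t; rewrite barycenter_antipode /antipode faces_map.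
rewrite -!map_comp !map_flatten -!map_comp; congr flatten.
apply: eq_map => w /=; rewrite -/(antipode w) IH -!map_comp.
by apply: eq_map.
Qed.

Lemma mem_subdiv (S : V -> Prop) n t u x :
  (forall s, s != [::] -> (forall y, y \in s -> S y) -> S (barycenter s)) ->
  size t = n -> (forall y, y \in t -> S y) ->
  u \in subdiv n t -> x \in u -> S x.
Proof.
move=> Sb; elim: n t u x => [|n IH] t u x tn tS.
  by rewrite inE => /eqP->; exact: tS.
case/mapP => v /flatten_mapP[w /mem_faces[sw wt] vw] ->; rewrite inE => /orP[/eqP->|xv].
  by apply: Sb => //; rewrite -size_eq0 tn.
apply: IH vw xv; first by move: sw; rewrite tn => -[].
by move=> y /wt; exact: tS.
Qed.
End Subdivision.

(** * The cross-polytope and the parity count *)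

Section Octahedron.
Variables (R : realFieldType) (V : lmodType R) (e : nat -> V).

(* The index j counts vertices: for 1 <= j, [octahedral_chain j] is a hemisphere of
   dimension j - 1 of the boundary of the cross-polytope, and its boundary is the
   chain of index j - 1 plus its antipode. *)
Fixpoint octahedral_chain (j : nat) : seq (seq V) :=
  if j is j'.+1 then
    if j' is 0 then [:: [:: e 0]] else
    map (cons (e j')) (octahedral_chain j' ++ map (@antipode R V) (octahedral_chain j'))
  else [::].

Definition sphere_chain (N j : nat) := iter N (subdiv_chain (R := R) j) (octahedral_chain j).

Lemma size_octahedral_chain j t : t \in octahedral_chain j -> size t = j.
Proof.
elim: j t => // -[|j] IH t; first by rewrite inE => /eqP->.
case/mapP => u; rewrite mem_cat => /orP[/IH + -> /=|/mapP[v /IH + ->] -> /=] => [->|] //.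
by rewrite size_map => ->.
Qed.

Lemma size_sphere_chain N j t : t \in sphere_chain N j -> size t = j.
Proof.
elim: N t => [|N IH] t; first exact: size_octahedral_chain.
by case/flatten_mapP => u /IH; exact: size_mem_subdiv.
Qed.

(** The base of the cone, a hemisphere plus its antipode, is a cycle: by induction the boundary of a
    hemisphere is antipodally symmetric, so both halves have the same boundary mod 2. In the lowest
    case both points have the empty tuple as face. *)
Lemma boundary_octahedral f j : (0 < j)%N ->
  chain_sum f (boundary (octahedral_chain j.+1)) =
  chain_sum f (octahedral_chain j ++ map (@antipode R V) (octahedral_chain j)).
Proof.
elim: j f => // j IH f _.
rewrite [in LHS]/= boundary_cone; move: (f \o _) => g.
suff -> : chain_sum g (boundary (octahedral_chain j.+1 ++
   map (@antipode R V) (octahedral_chain j.+1))) = false by rewrite addbF.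
have bcat C D : boundary (C ++ D) = boundary C ++ boundary D :> seq (seq V).
  by rewrite /boundary map_cat flatten_cat.
have banti C : boundary (map (@antipode R V) C) = map (@antipode R V) (boundary C).
  rewrite /boundary map_flatten -!map_comp; congr flatten; apply: eq_map => t.
  by rewrite /= /antipode faces_map.
case: j IH => [|j] IH.
  by rewrite bcat banti chain_sum_cat chain_sum_map /chain_sum /= !big_seq1 addbb.
rewrite bcat banti chain_sum_cat chain_sum_map !IH // !chain_sum_cat !chain_sum_map.
set a := chain_sum _ _; set b := chain_sum _ _; set c := chain_sum _ _.
suff -> : c = a by case: a b => [] [].
apply: eq_bigr => t _ /=; congr g; rewrite /antipode -map_comp.
by rewrite (eq_map (g := id)) ?map_id // => x /=; rewrite opprK.
Qed.

Lemma boundary_sphere_chain N f j : (0 < j)%N ->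
  chain_sum f (boundary (sphere_chain N j.+1)) =
  chain_sum f (sphere_chain N j) (+) chain_sum (f \o @antipode R V) (sphere_chain N j).
Proof.
move=> j0; elim: N f => [|N IH] f.
  by rewrite /= boundary_octahedral // chain_sum_cat chain_sum_map.
rewrite /sphere_chain !iterS boundary_subdiv_chain; last exact: size_sphere_chain.
rewrite -!/(sphere_chain _ _) [LHS]chain_sum_flatten IH /subdiv_chain !chain_sum_flatten.
congr (_ (+) _); apply: eq_chain_sum => t _ /=.
by rewrite subdiv_antipode chain_sum_map.
Qed.

Lemma sphere_chain1 N : sphere_chain N 1 = [:: [:: e 0]].
Proof.
elim: N => // N; rewrite /sphere_chain iterS => ->.
by rewrite /subdiv_chain /= /barycenter big_seq1 /= invr1 scale1r.
Qed.

Variables (N D : nat) (l : V -> nat).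
Hypothesis l_antipode : forall j t x, (j <= D)%N ->
  t \in sphere_chain N j -> x \in t -> l (- x) = flip (l x).
Hypothesis l_compl : forall j t x y, (j <= D)%N ->
  t \in sphere_chain N j -> x \in t -> y \in t -> l x != flip (l y).

(* Ky Fan's parity count: antipodality exchanges the two kinds of alternating
   simplices, so the boundary of a hemisphere contains as many simplices alternating
   from a given sign as the hemisphere one dimension below has alternating ones, mod 2. *)
Lemma fan_parity j : (0 < j <= D)%N ->
  chain_sum (fun t => sorted_alternating true (map l t) (+)
                      sorted_alternating false (map l t)) (sphere_chain N j) = true.
Proof.
elim: j => // -[|j] IH /andP[_ jD].
  rewrite sphere_chain1 /chain_sum big_seq1 /= /sorted_alternating /=.
  by case: (odd _).
rewrite -[RHS]IH ?(ltnW jD) //.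
(* Double counting: a simplex has an odd number of facets alternating from [true] exactly when it
   alternates itself, from either sign. *)
transitivity (chain_sum (fun t => sorted_alternating true (map l t))
    (boundary (sphere_chain N j.+2))).
  rewrite chain_sum_flatten; apply: eq_chain_sum => t /size_sphere_chain st.
  rewrite -(sorted_alternating_faces true); last by case: t st.
  by rewrite faces_map chain_sum_map.
rewrite boundary_sphere_chain // chain_sumD; congr (_ (+) _).
apply: eq_chain_sum => t tC /=; rewrite -map_comp.
have -> : map (l \o -%R) t = map flip (map l t).
  by rewrite -map_comp; apply/eq_in_map => x xt /=; apply: (l_antipode (ltnW jD) tC).
apply: sorted_alternating_flip => _ _ /mapP[x xt ->] /mapP[y yt ->].
exact: (l_compl (ltnW jD) tC).
Qed.

Lemma fan_alternating : (0 < D)%N ->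
  exists2 t, t \in sphere_chain N D & exists b, sorted_alternating b (map l t).
Proof.
move=> D0; have := fan_parity (j := D); rewrite D0 leqnn => /(_ isT).
rewrite /chain_sum; elim: (sphere_chain N D) => [|t C IH]; first by rewrite big_nil.
rewrite big_cons; case: (boolP (sorted_alternating _ _ (+) _)) => [tb _|_ /IH[u uC ub]]; last first.
  by exists u => //; rewrite inE uC orbT.
exists t; first exact: mem_head.
by move: tb; case tt: (sorted_alternating true _) => tb; [exists true|exists false].
Qed.
End Octahedron.

(** * Fine triangulations of the cross-polytope *)

Section Mesh.
Variables (R : realType) (V : normedModType R).
Implicit Types (t u : seq V).

Lemma norm_barycenter_sub t v (r : R) : t != [::] ->
  (forall x, x \in t -> `|v - x| <= r) -> `|v - barycenter t| <= r.
Proof.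
move=> t0 tr; have n0 : 0 < (size t)%:R :> R by rewrite ltr0n lt0n size_eq0.
have -> : v - barycenter t = (size t)%:R^-1 *: \sum_(x <- t) (v - x).
  rewrite sumrB scalerBr big_const_seq count_predT iter_addr_0.
  by rewrite -[v *+ _]scaler_nat scalerA mulVf ?scale1r // gt_eqF.
rewrite normrZ gtr0_norm ?invr_gt0 // mulrC ler_pdivrMr //.
apply: (le_trans (ler_norm_sum _ _ _)); apply: (@le_trans _ _ (\sum_(x <- t) r)).
  by rewrite big_seq [leRHS]big_seq; apply: ler_sum => x; exact: tr.
by rewrite big_const_seq count_predT iter_addr_0 mulr_natr.
Qed.

(** In the average of the differences [x - v] the term of [v] is zero, which saves one summand out
    of [size t]. *)
Lemma norm_barycenter_vertex t v (r : R) : v \in t ->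
  (forall x, x \in t -> `|x - v| <= r) ->
  `|barycenter t - v| <= (size t).-1%:R / (size t)%:R * r.
Proof.
move=> vt tr; have t0 : (0 < size t)%N by case: t vt {tr}.
have n0 : 0 < (size t)%:R :> R by rewrite ltr0n.
have -> : barycenter t - v = (size t)%:R^-1 *: \sum_(x <- rem v t) (x - v).
  have -> : \sum_(x <- rem v t) (x - v) = \sum_(x <- t) (x - v).
    by rewrite [RHS](big_rem v) //= subrr add0r.
  rewrite sumrB scalerBr big_const_seq count_predT iter_addr_0.
  by rewrite -[v *+ _]scaler_nat scalerA mulVf ?scale1r // gt_eqF.
rewrite normrZ gtr0_norm ?invr_gt0 // [_ / _]mulrC -mulrA ler_pM2l ?invr_gt0 //.
apply: (le_trans (ler_norm_sum _ _ _)).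
apply: (@le_trans _ _ (\sum_(x <- rem v t) r)).
  by rewrite big_seq [leRHS]big_seq; apply: ler_sum => x /mem_rem; exact: tr.
by rewrite big_const_seq count_predT iter_addr_0 size_rem // mulr_natl.
Qed.

(** One factor serves all dimensions, since (n-1)/n <= d/(d+1) for n <= d+1. Two new vertices either
    include the barycenter of [t] or lie in the subdivision of one facet. *)
Lemma mesh_subdiv d n t u (r : R) : (n <= d.+1)%N -> size t = n ->
  {in t &, forall x y, `|x - y| <= r} -> u \in subdiv n t ->
  {in u &, forall x y, `|x - y| <= d%:R / d.+1%:R * r}.
Proof.
elim: n t u => [|n IH] t u nd tn tr.
  by rewrite inE => /eqP-> x y; case: t tn {tr}.
case/mapP => v /flatten_mapP[w /mem_faces[sw wt] vw] ->.
have wn : size w = n by move: sw; rewrite tn => -[].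
have t0 : t != [::] by rewrite -size_eq0 tn.
have r0 : 0 <= r.
  case: (t) tn tr => // x s _ /(_ x x); rewrite subrr normr0 mem_head.
  by apply.
have bt z : z \in t -> `|barycenter t - z| <= d%:R / d.+1%:R * r.
  move=> zt; apply: (le_trans (norm_barycenter_vertex zt _)) => [x xt|]; first exact: tr.
  apply: ler_wpM2r => //; rewrite tn /= ler_pdivrMr ?ltr0n // mulrAC ler_pdivlMr ?ltr0n //.
  by rewrite -!natrM ler_nat !mulnS mulnC leq_add2r.
have bv z : z \in v -> `|barycenter t - z| <= d%:R / d.+1%:R * r.
  move=> zv; apply: (mem_subdiv (S := fun z => `|barycenter t - z| <= _) _ wn _ vw zv).
    by move=> s s0 sr; apply: norm_barycenter_sub.
  by move=> y /wt/bt.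
have c0 : 0 <= d%:R / d.+1%:R * r by rewrite mulr_ge0 // divr_ge0.
move=> x y; rewrite !inE => /orP[/eqP->|xv] /orP[/eqP->|yv].
- by rewrite subrr normr0.
- exact: bv.
- by rewrite distrC; exact: bv.
- apply: (IH w v _ wn _ vw) => //; first exact: ltnW.
  by move=> a b /wt at_ /wt bt_; exact: tr.
Qed.

Lemma mesh_sphere_chain (e : nat -> V) d N j t (r : R) : (j <= d.+1)%N ->
  (forall u, u \in octahedral_chain e j -> {in u &, forall x y, `|x - y| <= r}) ->
  t \in sphere_chain e N j ->
  {in t &, forall x y, `|x - y| <= (d%:R / d.+1%:R) ^+ N * r}.
Proof.
move=> jd er; elim: N t => [|N IH] t; first by rewrite expr0 mul1r; exact: er.
case/flatten_mapP => u uC /(mesh_subdiv jd (size_sphere_chain uC) (IH u uC)).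
by rewrite exprS mulrA.
Qed.
End Mesh.

Section Cross_polytope.
Variables (R : realType) (d : nat).

Definition unit_row (j : nat) : 'rV[R]_d.+1 := delta_mx ord0 (inord j).

Lemma coord_le_norm (x : 'rV[R]_d.+1) i : `|x ord0 i| <= `|x|.
Proof.
rewrite [leRHS]mx_normrE.
exact: (le_bigmax (0 : R) (fun ij : 'I_1 * 'I_d.+1 => `|x ij.1 ij.2|) (ord0, i)).
Qed.

Lemma norm_le_coord (x : 'rV[R]_d.+1) c : 0 <= c ->
  (forall i, `|x ord0 i| <= c) -> `|x| <= c.
Proof.
move=> c0 xc; rewrite [leLHS]mx_normrE; apply/bigmax_leP; split=> // -[i j] _ /=.
by rewrite ord1.
Qed.

Lemma norm_delta (i : 'I_d.+1) : `|delta_mx ord0 i : 'rV[R]_d.+1| <= 1.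
Proof.
apply: norm_le_coord => // j; rewrite mxE eqxx /=.
by case: (_ == _); rewrite ?normr1 ?normr0.
Qed.

(** The functional [a] will keep subdivided faces away from 0. As coordinates from [j] on vanish,
    the next vertex can prescribe its own entry of [a] without changing the values at the old
    vertices. *)
Lemma octahedral_face j t : (j <= d.+1)%N -> t \in octahedral_chain unit_row j ->
  exists2 a : 'cV[R]_d.+1, (forall i, `|a i ord0| <= 1) &
    forall x, x \in t -> [/\ x *m a = 1%:M, `|x| <= 1 &
      forall i : 'I_d.+1, (j <= i)%N -> x ord0 i = 0].
Proof.
have xda k (a : 'cV[R]_d.+1) : (unit_row k *m a) = (a (inord k) ord0)%:M.
  rewrite /unit_row -rowE; apply/rowP => i.
  by rewrite !mxE !ord1 eqxx mulr1n.
have nrm k : `|unit_row k| <= 1 by exact: norm_delta.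
elim: j t => // -[|j] IH t jd.
  rewrite inE => /eqP->; exists (const_mx 1) => [i|x]; first by rewrite mxE normr1.
  rewrite inE => /eqP->; split; [by rewrite xda mxE|exact: nrm|].
  move=> i i0; rewrite mxE eqxx /=; case: eqP i0 => // ->.
  by rewrite inordK.
case/mapP => u uC ->.
have {uC} : exists2 a : 'cV[R]_d.+1, (forall i, `|a i ord0| <= 1) &
    forall x, x \in u -> [/\ x *m a = 1%:M, `|x| <= 1 &
      forall i : 'I_d.+1, (j.+1 <= i)%N -> x ord0 i = 0].
  move: uC; rewrite mem_cat => /orP[/(IH _ (ltnW jd))//|/mapP[v /(IH _ (ltnW jd))[a a1 av] ->]].
  exists (- a) => [i|_ /mapP[x /av[xa x1 x0] ->]]; first by rewrite mxE normrN.
  split; rewrite ?normrN //; first by rewrite mulNmx mulmxN opprK.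
  by move=> i /x0; rewrite mxE => ->; rewrite oppr0.
case=> a a1 au; exists (\col_i (if i == inord j.+1 then 1 else a i ord0)).
  by move=> i; rewrite mxE; case: ifP; rewrite ?normr1.
move=> x; rewrite inE => /orP[/eqP->|/au[xa x1 x0]]; split=> //.
- by rewrite xda mxE eqxx.
- move=> i i0; rewrite mxE eqxx /=; case: eqP i0 => // ->.
  by rewrite inordK // ltnn.
- rewrite -xa; apply/matrixP => k l; rewrite !mxE; apply: eq_bigr => i _.
  rewrite !mxE !ord1; case: eqP => // ->.
  by rewrite x0 ?mul0r // inordK.
- by move=> i /ltnW/x0.
Qed.

Lemma sphere_chain_face N j t : (j <= d.+1)%N -> t \in sphere_chain unit_row N j ->
  exists2 a : 'cV[R]_d.+1, (forall i, `|a i ord0| <= 1) &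
    forall x, x \in t -> x *m a = 1%:M /\ `|x| <= 1.
Proof.
move=> jd; elim: N t => [|N IH] t.
  move=> /(octahedral_face jd)[a a1 at_]; exists a => // x /at_[? ? _]; split=> //.
case/flatten_mapP => u uC tu; have [a a1 au] := IH _ uC; exists a => // x xt.
apply: (mem_subdiv (S := fun x => x *m a = 1%:M /\ `|x| <= 1) _ (size_sphere_chain uC) au tu xt).
move=> s s0 sS; split; last first.
  rewrite -normrN -sub0r; apply: norm_barycenter_sub => // y /sS[_].
  by rewrite sub0r normrN.
rewrite -scalemxAl mulmx_suml (eq_big_seq (fun=> 1%:M)); last by move=> y /sS[].
rewrite big_const_seq count_predT iter_addr_0 -[1%:M *+ _]scaler_nat scalerA mulVf ?scale1r //.
by rewrite pnatr_eq0 size_eq0.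
Qed.

(** The value 1 of the functional [a] at [x] is a sum of d + 1 terms, each at most the maximum norm
    of [x]. *)
Lemma sphere_chain_norm N j t x : (j <= d.+1)%N -> t \in sphere_chain unit_row N j ->
  x \in t -> d.+1%:R^-1 <= `|x| <= 1.
Proof.
move=> jd /(sphere_chain_face jd)[a a1 at_] /at_[xa ->]; rewrite andbT.
rewrite -[_^-1]mul1r ler_pdivrMr ?ltr0n //.
have e1 : 1 = \sum_i x ord0 i * a i ord0.
  by move/matrixP: xa => /(_ ord0 ord0); rewrite !mxE.
rewrite [leLHS]e1.
apply: (le_trans (ler_norm _)); apply: (le_trans (ler_norm_sum _ _ _)).
apply: (@le_trans _ _ (\sum_(i < d.+1) `|x|)).
  apply: ler_sum => i _; rewrite normrM -[leRHS]mulr1.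
  by apply: ler_pM => //; exact: coord_le_norm.
by rewrite sumr_const card_ord mulr_natr.
Qed.

Lemma small_sphere_chain (r : R) : 0 < r -> exists N, forall j t, (j <= d.+1)%N ->
  t \in sphere_chain unit_row N j -> {in t &, forall x y, `|x - y| < r}.
Proof.
move=> r0; set c : R := d%:R / d.+1%:R.
have c1 : `|c| < 1.
  by rewrite ger0_norm ?divr_ge0 // ltr_pdivrMr ?ltr0n // mul1r ltr_nat.
have /cvgr0_norm_lt/(_ (r / 2)) := cvg_expr c1.
rewrite divr_gt0 // => /(_ isT)[N _ /(_ N (leqnn N)) /= cN].
exists N => j t jd tC x y xt yt.
(* The factor 2 bounds the diameter of a face whose vertices have norm at most 1. *)
apply: (@le_lt_trans _ _ (c ^+ N * 2)).
  apply: (mesh_sphere_chain jd _ tC) => // u uC v w xu yu.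
  have [a _ au] := octahedral_face jd uC.
  have [_ x1 _] := au _ xu; have [_ y1 _] := au _ yu.
  by apply: (le_trans (ler_normB _ _)); apply: lerD.
by rewrite -ltr_pdivlMr // (le_lt_trans (ler_norm _)).
Qed.
End Cross_polytope.

Local Open Scope classical_set_scope.

(** * The lower bound *)

Lemma alternating_count b s : alternating b s ->
  count (pred1 b) s = uphalf (size s) /\ count (pred1 (~~ b)) s = (size s)./2.
Proof.
elim: s b => // c s IH b /= /andP[/eqP-> /IH]; rewrite negbK => -[-> ->].
by rewrite eqxx; case: b.
Qed.

Section Rank.
Variables (n k : nat) (P : pred 'I_k).

Definition initial (j : nat) := [pred i : 'I_k | P i & (i <= j)%N].

Definition nth_smallest : nat := find (fun j => n <= #|initial j|)%N (iota 0 k).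

Lemma nth_smallestP : (0 < n <= #|P|)%N -> exists i : 'I_k,
  [/\ i = nth_smallest :> nat, P i & (n <= #|initial i|)%N].
Proof.
move=> /andP[n0 nP]; pose Q j := (n <= #|initial j|)%N.
have k0 : (0 < k)%N.
  by apply: leq_trans (leq_trans n0 nP) _; rewrite -[leqRHS]card_ord max_card.
have hasQ : has Q (iota 0 k).
  apply/hasP; exists k.-1; first by rewrite mem_iota /= add0n prednK.
  apply: (leq_trans nP); apply: subset_leq_card; apply/fintype.subsetP => i Pi.
  by rewrite inE [P i]Pi /= -ltnS prednK.
have jk : (nth_smallest < k)%N by rewrite -[ltnRHS](size_iota 0) -has_find.
have := nth_find 0%N hasQ; rewrite nth_iota // add0n => Qj.
(* If this index were not in [P], the count [n] would be reached one index earlier, against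
   minimality; at index 0 there would be no member at all, against n > 0. *)
exists (Ordinal jk); split => //; apply: contraT => NP.
have : #|initial nth_smallest| = #|[pred i : 'I_k | P i & (i < nth_smallest)%N]|.
  apply: eq_card => i; rewrite !inE ltn_neqAle; case: (boolP (P i)) => //= Pi.
  case: eqP => //= ij; move: NP; rewrite (_ : Ordinal jk = i) ?Pi //.
  exact: val_inj.
move: Qj; rewrite /Q -/nth_smallest => Qj cardE; clear NP.
case E : nth_smallest => [|j].
  move: n0; rewrite ltnNge (leq_trans Qj) // cardE E.
  by rewrite leqn0; apply/eqP; apply: eq_card0 => i; rewrite !inE andbF.
have jj : (j < find Q (iota 0 k))%N by rewrite -/nth_smallest E.
have := before_find 0%N jj; rewrite nth_iota ?add0n; last first.
  by apply: ltn_trans jk; rewrite E.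
by rewrite /Q; move: Qj; rewrite cardE E => ->.
Qed.
End Rank.

(** * Radial projection and cones over the sets *)

Section Radial.
Variables (R : realType) (d : nat).
Implicit Types x y : 'rV[R]_d.+1.

Definition norm2 x : R := Num.sqrt (\sum_i x ord0 i ^+ 2).
(* [radial 0 = 0], so [radial x] lies on the sphere only if [x != 0]. *)
Definition radial x : 'rV[R]_d.+1 := (norm2 x)^-1 *: x.

Lemma radialN x : radial (- x) = - radial x.
Proof.
rewrite /radial scalerN; congr (- (_^-1 *: _)); congr Num.sqrt.
by apply: eq_bigr => i _; rewrite mxE sqrrN.
Qed.

Lemma norm2_gt0 x : x != 0 -> 0 < norm2 x.
Proof.
move=> x0; rewrite sqrtr_gt0 lt_neqAle sumr_ge0 ?andbT; last by move=> *; exact: sqr_ge0.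
apply: contra x0 => /eqP/esym/psumr_eq0P x0; apply/eqP/rowP => i.
by apply/eqP; rewrite mxE -sqrf_eq0 x0 // => j _; exact: sqr_ge0.
Qed.

Lemma sum_sqr_radial x : x != 0 -> \sum_i radial x ord0 i ^+ 2 = 1.
Proof.
move=> x0; under eq_bigr do rewrite mxE exprMn.
rewrite -mulr_sumr exprVn sqr_sqrtr ?sumr_ge0 //; last by move=> *; exact: sqr_ge0.
by rewrite mulVf // gt_eqF // -sqrtr_gt0; exact: norm2_gt0.
Qed.

Lemma radial_neq0 x : radial x != 0 -> x != 0.
Proof. by apply: contra => /eqP->; rewrite /radial scaler0. Qed.

Lemma continuous_row_sum (f : 'I_d.+1 -> R -> R) :
  (forall i, continuous (f i)) ->
  continuous (fun x : 'rV[R]_d.+1 => \sum_i f i (x ord0 i)).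
Proof.
move=> fc x; rewrite /continuous_at.
elim: (index_enum _) => [|i s IH].
  rewrite big_nil (_ : (fun _ => _) = cst 0); first exact: (cvg_cst _ (FF := nbhs_filter (x : 'rV[R]_d.+1))).
  by apply/funext => z; rewrite big_nil.
rewrite big_cons (_ : (fun _ => _) = (fun z : 'rV[R]_d.+1 => f i (z ord0 i)) \+
  (fun z : 'rV[R]_d.+1 => \sum_(j <- s) f j (z ord0 j))); last first.
  by apply/funext => z; rewrite big_cons.
apply: cvgD IH; apply: (continuous_comp (f := fun z : 'rV[R]_d.+1 => z ord0 i)) (fc i _).
exact: coord_continuous.
Qed.

Lemma radial_continuous x : x != 0 -> {for x, continuous radial}.
Proof.
move=> x0; rewrite /continuous_at /radial.
have FF := nbhs_filter (x : 'rV[R]_d.+1).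
apply: (cvgZ (s := fun z => (norm2 z)^-1) (f := id)); last exact: cvg_id.
apply: (cvgV (f := norm2)); first by rewrite gt_eqF // norm2_gt0.
have sc : {for x, continuous (fun z : 'rV[R]_d.+1 => \sum_i z ord0 i ^+ 2)}.
  exact: (continuous_row_sum (fun _ => @exprn_continuous R 2)).
apply: (@continuous_comp _ _ _ _ _ x sc); exact: sqrt_continuous.
Qed.

Lemma near_radial (U : set 'rV[R]_d.+1) x : open U -> x != 0 -> U (radial x) ->
  exists2 r : R, 0 < r & forall y, `|x - y| < r -> y != 0 /\ U (radial y).
Proof.
move=> oU x0 Ux.
have /nbhs_normP[r1 /= r10 r1U] := radial_continuous x0 (open_nbhs_nbhs (conj oU Ux)).
have x_gt0 : 0 < `|x| by rewrite normr_gt0.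
exists (Num.min r1 `|x|); first by rewrite lt_min r10.
move=> y; rewrite lt_min => /andP[/r1U Uy yx]; split=> //.
by apply: contraTneq yx => ->; rewrite subr0 ltxx.
Qed.
End Radial.

Lemma sphere_neq0 d (x : pt d) : unit_sphere d x -> x != 0.
Proof.
rewrite /unit_sphere /= => x1; apply/eqP => x0; move: x1.
rewrite x0 big1; first by move/esym/eqP; rewrite oner_eq0.
by move=> i _; rewrite mxE expr0n.
Qed.

(** Replacing the sets by cones lets the argument run on the cross-polytope, without moving vertices
    to the sphere. The origin causes no trouble, as [radial 0 = 0] is off the sphere. *)
Lemma open_cone d (A : set (pt d)) (x : pt d) : open_in_sphere A -> A (radial x) ->
  exists2 r : Rdefinitions.R, 0 < r & forall y : pt d, `|x - y| < r -> A (radial y).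
Proof.
move=> [U [oU ->]] [Ux /sphere_neq0/radial_neq0 x0].
have [r r0 rU] := near_radial oU x0 Ux.
exists r => // y /rU[y0 Uy]; split=> //; exact: sum_sqr_radial.
Qed.

Lemma compact_shell (R : realType) d (c : R) :
  compact [set x : 'rV[R]_d.+1 | c <= `|x| <= 1].
Proof.
apply: bounded_closed_compact.
  exists 1; split=> // r r1 x /= /andP[_ /le_trans]; apply; exact: ltW.
rewrite (_ : [set _ | _] = (fun x : 'rV[R]_d.+1 => `|x|) @^-1` `[c, 1]%classic).
  apply: preimage_closed; last exact: itv_closed.
  by move=> x _; exact: norm_continuous.
by apply/seteqP; split=> x /=; rewrite in_itv.
Qed.

Definition ball_within (R : realType) (V : normedModType R) (r : R) (A : set V) (x : V) :=
  forall y, `|x - y| < r -> A y.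

(** Around each [x] some radius [s] serves all sets containing [x]; points within s/2 of [x] then
    keep balls of radius below s/2 in all these sets. Compactness makes the radius uniform. *)
Lemma lebesgue_number (R : realType) (V : normedModType R) (k n : nat)
    (G : 'I_k -> set V) (K : set V) : compact K ->
  (forall i x, G i x -> exists2 r : R, 0 < r & ball_within r (G i) x) ->
  (forall x, K x -> (n <= #|[pred i | `[< G i x >]]|)%N) ->
  exists2 delta : R, 0 < delta & forall x, K x ->
    (n <= #|[pred i | `[< ball_within delta (G i) x >]]|)%N.
Proof.
move=> /compact_near_coveringP cK oG nG.
pose P (e : R) (x : V) := (n <= #|[pred i | `[< ball_within e (G i) x >]]|)%N.
have : \forall e \near 0^'+, K `<=` P e.
  apply: cK => x Kx.
  have rP i : exists r : R, 0 < r /\ (G i x -> ball_within r (G i) x).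
    have [/oG[r r0 rG]|nGx] := pselect (G i x); first by exists r.
    by exists 1; split.
  have /choice[r rG] := rP.
  pose s := \big[Num.min/1]_i r i.
  have s0 : 0 < s by apply: lt_bigmin => // i _; case: (rG i).
  have s2 : 0 < s / 2 by rewrite divr_gt0.
  near=> y e; apply: (leq_trans (nG x Kx)); apply: subset_leq_card.
  apply/fintype.subsetP => i; rewrite !inE /= => Gi z yz.
  case: (rG i) => _ /(_ Gi); apply.
  apply: (@lt_le_trans _ _ s); last exact: bigmin_le.
  rewrite -[x - z](subrKA y) (splitr s); apply: (le_lt_trans (ler_normD _ _)).
  apply: ltrD; last apply: (lt_trans yz).
    near: y; apply/nbhs_normP; exists (s / 2) => //.
  near: e; exact: nbhs_right_lt.
move=> eK; have /filter_ex[e [e0 Ke]] : \forall e \near 0^'+, 0 < e /\ K `<=` P e.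
  by apply: filterI eK; exact: nbhs_right_gt.
by exists e.
Unshelve. all: by end_near. Qed.

Section Hemisphere.
Variables (R : realType) (d : nat).
Implicit Types x : 'rV[R]_d.+1.

(* Points of the equator are assigned to the two sides in antipodal pairs. *)
Definition upper x : bool :=
  if x ord0 ord_max != 0 then 0 < x ord0 ord_max
  else 0 < x ord0 (odflt ord0 [pick i | x ord0 i != 0]).

Lemma upperN x : x != 0 -> upper (- x) = ~~ upper x.
Proof.
move=> x0; rewrite /upper mxE oppr_eq0 oppr_gt0.
have flipP i : x ord0 i != 0 -> (x ord0 i < 0) = ~~ (0 < x ord0 i).
  by move=> xi; rewrite -leNgt lt_neqAle xi.
case: ifPn => [/flipP //|_].
rewrite (@eq_pick _ _ (fun i => x ord0 i != 0)) => [|i]; last by rewrite mxE oppr_eq0.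
rewrite mxE oppr_gt0; case: pickP => [i /flipP //|x_eq0].
case/eqP: x0; apply/rowP => i; rewrite mxE; apply/eqP.
by have /negbFE := x_eq0 i.
Qed.

Lemma upper_ge0 x : upper x -> 0 <= x ord0 ord_max.
Proof. by rewrite /upper; case: eqP => [->//|_] /= /ltW. Qed.

Lemma lower_le0 x : ~~ upper x -> x ord0 ord_max <= 0.
Proof. by rewrite /upper; case: eqP => [->//|_] /=; rewrite -leNgt. Qed.

(** Indices are read off at this representative of the pair [x], [-x], so both points get the same
    one. *)
Definition reflect_up x := if upper x then x else - x.

Lemma reflect_upN x : x != 0 -> reflect_up (- x) = reflect_up x.
Proof. by move=> x0; rewrite /reflect_up upperN //; case: (upper x) => //=; rewrite opprK. Qed.
End Hemisphere.

(** Consecutive labels with equal index and opposite signs would be exchanged by [flip], which the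
    last hypothesis forbids. *)
Lemma alternating_half_sorted b s : sorted leq s -> alternating b (map odd s) ->
  {in s &, forall c c', c != flip c'} -> sorted ltn (map half s).
Proof.
elim: s b => // c [|c' s] IH b //= /andP[cc' ss] /and3P[/eqP cb /eqP c'b alt] nc.
apply/andP; split; last first.
  apply: (IH (~~ b)) => //=; first by rewrite c'b eqxx.
  by move=> x y xs ys; apply: nc; rewrite inE ?xs ?ys orbT.
rewrite ltn_neqAle half_leq // andbT; apply/eqP => hh.
have /eqP : c != flip c' by apply: nc; rewrite !inE eqxx ?orbT.
apply; rewrite /flip -[c]odd_double_half -{2 3}[c']odd_double_half hh cb c'b.
by case: b {cb c'b alt} => /=.
Qed.

(** * Labels and the southern point of high multiplicity *)

Section Labels.
Variables (R : realType) (d k n : nat) (G : 'I_k -> set 'rV[R]_d.+1) (delta c : R).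
Hypothesis n_gt0 : (0 < n)%N.
Hypothesis delta_gt0 : 0 < delta.
Hypothesis G_antipodal : forall i x, G i x -> ~ G i (- x).
Hypothesis G_fold : forall x, c <= `|x| <= 1 ->
  (n <= #|[pred i | `[< ball_within delta (G i) x >]]|)%N.
Implicit Types x y z : 'rV[R]_d.+1.

Definition robust x : pred 'I_k :=
  [pred i | `[< ball_within delta (G i) (reflect_up x) >]].

(* The parity of a label records the hemisphere, its half an index of a set. *)
Definition label x : nat := (upper x + (nth_smallest n (robust x)).*2)%N.

Lemma odd_label x : odd (label x) = upper x.
Proof. by rewrite /label oddD odd_double addbF; case: (upper x). Qed.

Lemma half_label x : (label x)./2 = nth_smallest n (robust x).
Proof. by rewrite /label half_bit_double. Qed.

Lemma labelN x : x != 0 -> label (- x) = flip (label x).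
Proof.
move=> x0; have rx : robust (- x) = robust x by rewrite /robust reflect_upN.
rewrite /flip odd_label /label upperN // rx.
by case: (upper x).
Qed.

Lemma label_witness x : c <= `|x| <= 1 -> exists i : 'I_k,
  [/\ i = (label x)./2 :> nat, robust x i & (n <= #|initial (robust x) i|)%N].
Proof.
move=> xc; rewrite half_label; apply: nth_smallestP; rewrite n_gt0 /=.
by apply: G_fold; rewrite /reflect_up; case: ifP; rewrite ?normrN.
Qed.

Lemma label_not_flip x y : c <= `|x| <= 1 -> c <= `|y| <= 1 -> `|x - y| < delta ->
  label x != flip (label y).
Proof.
move=> xc yc xy; apply/eqP => lxy.
have uxy : upper x = ~~ upper y by rewrite -!odd_label lxy odd_flip.
have hxy : (label x)./2 = (label y)./2.
  by rewrite lxy /flip odd_label /label; case: (upper y); rewrite ?half_bit_double //= ?uphalf_half ?odd_double ?doubleK.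
have [i [ix Gx _]] := label_witness xc; have [j [jy Gy _]] := label_witness yc.
have ji : j = i by apply: ord_inj; exact: etrans jy (etrans (esym hxy) (esym ix)).
move: Gy; rewrite {}ji {j jy} => /asboolP Gy; move: Gx => /asboolP Gx.
have Gc z : ball_within delta (G i) z -> G i z by apply; rewrite subrr normr0.
(* As [x] and [y] lie on opposite sides, the antipode of [reflect_up x] is within [delta] of
   [reflect_up y], so [G i] would contain an antipodal pair. *)
apply: (G_antipodal (Gc _ Gx)); apply: Gy.
rewrite opprK /reflect_up uxy; case: (upper y) => /=; last by rewrite addrC.
by rewrite distrC.
Qed.

Lemma alternating_multiplicity b t : (1 <= d)%N -> size t = d.+1 ->
  (forall x, x \in t -> c <= `|x| <= 1) ->
  {in t &, forall x y, `|x - y| < delta / 2} ->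
  sorted_alternating b (map label t) ->
  exists2 y : 'rV[R]_d.+1, y ord0 ord_max < 0 & (n + d./2 <= #|[pred i | `[< G i y >]]|)%N.
Proof.
move=> d1 st tc tdelta; rewrite /sorted_alternating; set L := sort leq _ => alt.
have sL : size L = d.+1 by rewrite size_sort size_map.
have Lt l : l \in L -> exists2 x, x \in t & label x = l.
  by rewrite mem_sort => /mapP[x xt ->]; exists x.
have d2 : delta / 2 < delta by rewrite ltr_pdivrMr // ltr_pMr // ltr1n.
have halfL : sorted ltn (map half L).
  apply: alternating_half_sorted alt _; first exact: sort_sorted leq_total _.
  move=> _ _ /Lt[x xt <-] /Lt[y yt <-]; apply: label_not_flip; rewrite ?tc //.
  exact: lt_trans (tdelta _ _ xt yt) d2.
have [cb cNb] := alternating_count alt.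
(* The sign opposite to the first one occurs (d+1)/2 times, rounded down, hence at least once as d
   >= 1. *)
have [z zt zb] : exists2 z, z \in t & upper z = ~~ b.
  have : has (pred1 (~~ b)) (map odd L).
    by rewrite has_count cNb size_map sL; case: (d) d1.
  rewrite has_map => /hasP[l /Lt[x xt <-] /eqP /=]; rewrite odd_label => xb.
  by exists x.
(* The indices at the vertices of the first sign [b]; this sign occurs once more than d/2 rounded
   down. *)
pose J := [seq l./2 | l <- L & odd l == b].
have JL j : j \in J -> exists x, [/\ x \in t, upper x = b & (label x)./2 = j].
  case/mapP => l; rewrite mem_filter => /andP[/eqP lb /Lt[x xt xl]] ->.
  by exists x; rewrite -odd_label xl.
have sJ : size J = (d./2).+1.
  rewrite size_map size_filter -[LHS](count_map odd (pred1 b)) cb size_map sL.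
  by [].
have Jsorted : sorted ltn J.
  by apply: subseq_sorted halfL; [exact: ltn_trans|exact/map_subseq/filter_subseq].
(* [y] is pushed strictly south of a vertex of the minority sign, which may lie on
   the equator. *)
pose y : 'rV[R]_d.+1 := (if b then z else - z) - (delta / 4) *: delta_mx ord0 ord_max.
have d4 : 0 < delta / 4 by rewrite divr_gt0.
(* The point [y] is at distance less than delta/2 + delta/4 < delta from [reflect_up x] when [x] has
   sign [b]. *)
have near_y x i : x \in t -> upper x = b -> robust x i -> G i y.
  move=> xt xb /asboolP; apply; rewrite /reflect_up xb /y opprB addrA.
  rewrite [X in X - _]addrC -addrA.
  apply: (le_lt_trans (ler_normD _ _)).
  have e4 : `|(delta / 4) *: delta_mx ord0 ord_max : 'rV[R]_d.+1| <= delta / 4.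
    rewrite normrZ gtr0_norm // -[leRHS]mulr1 ler_pM2l //; exact: norm_delta.
  have xz : `|(if b then x else - x) - (if b then z else - z)| < delta / 2.
    by case: (b); [|rewrite -opprD normrN]; exact: tdelta.
  by apply: (lt_le_trans (ler_ltD e4 xz)); lra.
exists y.
  rewrite /y !mxE !eqxx mulr1 subr_lt0; apply: le_lt_trans d4.
  case: (b) zb => zb; first by apply: lower_le0; rewrite zb.
  by rewrite mxE oppr_le0; apply: upper_ge0; rewrite zb.
(* The first index [j0] accounts for [n] sets of index at most [j0]; each later one gives a further
   set, of index above [j0]. *)
case: J JL sJ Jsorted => // j0 J' JL [sJ'] /= Jpath.
have [x0 [x0t x0b x0j]] := JL j0 (mem_head _ _).
have [i0 [i0j _ ni0]] := label_witness (tc _ x0t).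
pose S1 := [pred i : 'I_k | (i : nat) \in J'].
have S1J : (size J' <= #|S1|)%N.
  rewrite cardE -(size_map val); apply: uniq_leq_size.
    by apply: (sorted_uniq ltn_trans ltnn); exact: path_sorted Jpath.
  move=> j jJ; have [x [xt _ xj]] := JL j (mem_behead (jJ : j \in behead (j0 :: J'))).
  have [i [ij _ _]] := label_witness (tc _ xt).
  by apply/mapP; exists i; rewrite ?mem_enum ?inE /= ij xj.
have disj : #|[predI initial (robust x0) i0 & S1]| = 0%N.
  apply: eq_card0 => i; rewrite !inE; apply/negP => /andP[/andP[_ ii0] iJ].
  have := order_path_min ltn_trans Jpath => /allP/(_ _ iJ) /=.
  by rewrite ltnNge -x0j -i0j ii0.
apply: leq_trans (_ : #|[predU initial (robust x0) i0 & S1]| <= _)%N.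
  have := cardUI (initial (robust x0) i0) S1; rewrite disj addn0 => ->.
  by rewrite leq_add // -sJ'.
apply: subset_leq_card; apply/fintype.subsetP => i; rewrite !inE => /orP[/andP[ri _]|iJ].
  exact: near_y x0t x0b ri.
have [x [xt xb xj]] := JL i (mem_behead (iJ : (i : nat) \in behead (j0 :: J'))).
have [i' [i'j ri' _]] := label_witness (tc _ xt).
have <- : i' = i by apply: ord_inj; exact: etrans i'j xj.
exact: near_y xt xb ri'.
Qed.
End Labels.

Lemma multE d k (F : 'I_k -> set (pt d)) x : mult F x = #|[pred i | `[< F i x >]]|.
Proof.
apply: eq_card => i; change (`[< x \in F i >] = `[< F i x >]).
by apply: asbool_equiv_eq; rewrite in_setE.
Qed.

Section LowerBound.
Variables (d n m k : nat) (F : 'I_k -> set (pt d)).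
Hypothesis coverF : antipodal_nm_open_cover n m F.

Lemma cover_lower_bound : (1 <= d)%N -> (1 <= n)%N -> (d./2 + n + m <= k)%N.
Proof.
move=> d1 n1; have [openF antiF foldF northF] := coverF.
set R : realType := Rdefinitions.R.
pose G i : set 'rV[R]_d.+1 := [set x | F i (radial x)].
pose c : R := d.+1%:R^-1.
have c0 : 0 < c by rewrite invr_gt0 ltr0n.
have antiG i (x : 'rV[R]_d.+1) : G i x -> ~ G i (- x).
  rewrite /G /= radialN => Gx; have := antiF i (radial x).
  by rewrite !inE => /(_ Gx) /negP; rewrite inE.
have neq0 (x : 'rV[R]_d.+1) : c <= `|x| <= 1 -> x != 0.
  by move=> /andP[cx _]; rewrite -normr_gt0 (lt_le_trans c0).
have [delta delta0 foldG] : exists2 delta : R, 0 < delta &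
    forall x : 'rV[R]_d.+1, c <= `|x| <= 1 ->
      (n <= #|[pred i | `[< ball_within delta (G i) x >]]|)%N.
  apply: (@lebesgue_number R 'rV[R]_d.+1 k n G _ (@compact_shell R d c)) => [i x Gx|x /neq0 x0].
    exact: open_cone (openF i) Gx.
  by rewrite -multE; apply: foldF; rewrite inE; exact: sum_sqr_radial.
have delta2 : 0 < delta / 2 by rewrite divr_gt0.
have [N meshN] := small_sphere_chain d delta2.
have shell j t x : (j <= d.+1)%N -> t \in sphere_chain (unit_row R d) N j ->
    x \in t -> c <= `|x| <= 1 by exact: sphere_chain_norm.
have [t tC [b altb]] : exists2 t, t \in sphere_chain (unit_row R d) N d.+1 &
    exists b, sorted_alternating b (map (label n G delta) t).
  apply: fan_alternating => // [j t x jd tC xt|j t x y jd tC xt yt].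
    exact/labelN/neq0/(shell _ _ _ jd tC xt).
  apply: (label_not_flip n1 delta0 antiG foldG); [exact: shell jd tC xt|exact: shell jd tC yt|].
  apply: lt_trans (meshN _ _ jd tC x y xt yt) _.
  by rewrite ltr_pdivrMr // ltr_pMr // ltr1n.
have [y y0 ny] := alternating_multiplicity n1 delta0 antiG foldG d1
  (size_sphere_chain tC) (fun x => shell _ _ x (leqnn _) tC)
  (meshN _ _ (leqnn _) tC) altb.
have yN0 : - y != 0 by rewrite oppr_eq0; apply: contraTneq y0 => ->; rewrite mxE ltxx.
have my : (m <= #|[pred i | `[< G i (- y) >]]|)%N.
  rewrite -multE; apply: northF; rewrite inE; split.
    by rewrite inE; exact: sum_sqr_radial.
  by rewrite !mxE mulr_gt0 ?oppr_gt0 // invr_gt0 norm2_gt0.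
(* No set contains both [y] and [-y], so the two counts add up to at most [k]. *)
have disj : #|[predI [pred i | `[< G i y >]] & [pred i | `[< G i (- y) >]]]| = 0%N.
  apply: eq_card0 => i; rewrite !inE; apply/negP => /andP[/asboolP Gy /asboolP].
  exact: antiG.
rewrite -[leqRHS]card_ord (addnC d./2); apply: leq_trans (leq_add ny my) _.
by rewrite -cardUI disj addn0; exact: max_card.
Qed.
End LowerBound.

(** * The upper bound *)

Section Gale.
Variable R : realFieldType.

Lemma Vandermonde_gt0 n (a : 'rV[R]_n) :
  (forall i j : 'I_n, (i < j)%N -> a ord0 i < a ord0 j) -> 0 < \det (Vandermonde n a).
Proof.
move=> aP; rewrite det_Vandermonde; apply: prodr_gt0 => i _.
by apply: prodr_gt0 => j ij; rewrite subr_gt0 aP.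
Qed.

(** The inner product of [y] with the point (1, t, ..., t^d) of the moment curve. *)
Definition eval_row d (y : 'rV[R]_d.+1) (t : R) : R := \sum_j y ord0 j * t ^+ j.

(* The cofactors of the last row of a Vandermonde matrix annihilate the values of
   polynomials of degree at most d, and their signs alternate. *)
Lemma alternating_values_eq0 d (y : 'rV[R]_d.+1) (a : 'rV[R]_d.+2) :
  (forall i j : 'I_d.+2, (i < j)%N -> a ord0 i < a ord0 j) ->
  (forall i : 'I_d.+2, (-1) ^+ i * eval_row y (a ord0 i) <= 0) -> y = 0.
Proof.
move=> aP yP.
have a'P k : 0 < \det (Vandermonde d.+1 (col' k a)).
  apply: Vandermonde_gt0 => i j ij; rewrite !mxE; apply: aP.
  by rewrite /= ltnNge leq_bump2 -ltnNge.
pose V := Vandermonde d.+2 a.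
have cof j : cofactor V ord_max j = (-1) ^+ (d.+1 + j) * \det (Vandermonde d.+1 (col' j a)).
  rewrite /cofactor; congr (_ * \det _); apply/matrixP => r s.
  by rewrite !mxE /= /bump leqNgt ltn_ord add0n.
have rel : \sum_j cofactor V ord_max j * eval_row y (a ord0 j) = 0.
  (* An off-diagonal entry of the product of [V] with its adjugate. *)
  have VadjV (i : 'I_d.+1) : \sum_j a ord0 j ^+ i * cofactor V ord_max j = 0.
    have := mul_mx_adj V => /matrixP/(_ (widen_ord (leqnSn _) i) ord_max).
    rewrite !mxE (_ : (_ == _) = false) ?mulr0n; last first.
      by apply/eqP => /(congr1 val) /=; have := ltn_ord i; lia.
    by move=> E; rewrite -[RHS]E; apply: eq_bigr => j _; rewrite !mxE.
  under eq_bigr do rewrite /eval_row mulr_sumr.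
  rewrite exchange_big big1 //= => i _.
  transitivity (y ord0 i * \sum_j a ord0 j ^+ i * cofactor V ord_max j).
    by rewrite mulr_sumr; apply: eq_bigr => j _; ring.
  by rewrite VadjV mulr0.
pose D j := \det (Vandermonde d.+1 (col' j a)).
(* All these summands are nonnegative, so each of them vanishes. *)
have sum0 : \sum_j - (D j * ((-1) ^+ j * eval_row y (a ord0 j))) = 0.
  transitivity (- (-1) ^+ d.+1 * \sum_j cofactor V ord_max j * eval_row y (a ord0 j)).
    rewrite mulr_sumr; apply: eq_bigr => j _; rewrite cof exprD -/(D j).
    rewrite -[D j in LHS]mul1r -[X in X * D j](sqrr_sign R d.+1) expr2; ring.
  by rewrite rel mulr0.
have y0 j : eval_row y (a ord0 j) = 0.
  move/eqP: sum0; rewrite psumr_eq0; last first.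
    by move=> i _; rewrite oppr_ge0 pmulr_rle0 // a'P.
  move/allP/(_ j (mem_index_enum _)) => /=; rewrite oppr_eq0 !mulf_eq0.
  by rewrite gt_eqF ?a'P //= signr_eq0 /= => /eqP.
(* A polynomial of degree at most d with d + 1 distinct zeros is zero. *)
have yV : y *m Vandermonde d.+1 (col' ord_max a) = 0.
  by apply/rowP => j; rewrite !mxE -[RHS](y0 (lift ord_max j)); apply: eq_bigr => i _; rewrite !mxE.
have uV : Vandermonde d.+1 (col' ord_max a) \in unitmx.
  by rewrite unitmxE unitfE gt_eqF // a'P.
by rewrite -[y](mulmxK uV) yV mul0mx.
Qed.

Lemma nth_alternating b s i : alternating b s -> (i < size s)%N ->
  nth false s i = b (+) odd i.
Proof.
elim: s b i => // c s IH b [|i] /= /andP[/eqP cb alt] si; first by rewrite cb addbF.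
by rewrite (IH (~~ b)) //=; case: b {cb alt}; case: (odd i).
Qed.

Lemma alternating_odd_iota m l : alternating (odd m) (map odd (iota m l)).
Proof. by elim: l m => //= l IH m; rewrite eqxx -[~~ _]/(odd m.+1) IH. Qed.

(* Deleting an entry together with its successor preserves alternation. *)
Lemma alternating_avoid (a : pred nat) b s : alternating b (map odd s) ->
  exists s' : seq nat, [/\ subseq s' s, all (predC a) s', alternating b (map odd s') &
    (size s <= size s' + 2 * count a s)%N].
Proof.
elim: (size s).+1 {-2}s (ltnSn (size s)) b => // N IH {}s sN b.
case: s sN => [|c s] sN; first by exists [::].
case ac : (a c); last first.
  move=> /= /andP[cb /(IH _ sN)[s' [ss as' alt' sz]]].
  by exists (c :: s'); rewrite /= ac eqxx cb add0n addSn.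
case: s sN => [|c' s] sN; first by exists [::]; rewrite /= ac.
move=> /= /and3P[_ _]; rewrite negbK => /(IH _ (ltnW sN))[s' [ss as' alt' sz]].
exists s'; split => //.
  exact: subseq_trans ss (subseq_trans (subseq_cons s c') (subseq_cons (c' :: s) c)).
by rewrite /= ac; case: (a c') => /=; lia.
Qed.

(** If at most n - 1 signed values were positive, deleting each such index with a neighbour would
    leave at least d + 2n - 2(n-1) = d + 2 indices of alternating parity, all with signed value at
    most 0. This forces [y = 0]. *)
Lemma gale d n (y : 'rV[R]_d.+1) : y != 0 ->
  (n <= count (fun i => 0 < (-1) ^+ i * eval_row y i%:R)%R (iota 0 (d + 2 * n)))%N.
Proof.
move=> y0; set a := (fun i : nat => _); rewrite leqNgt; apply: contra y0 => an.
have [s [ss as_ alt sz]] := alternating_avoid a (alternating_odd_iota 0 (d + 2 * n)).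
have ds : (d.+2 <= size s)%N by move: sz; rewrite size_iota; lia.
have ltn_s : sorted ltn s by apply: subseq_sorted ss (iota_ltn_sorted 0 _); exact: ltn_trans.
suff : y = 0 by move->.
apply: (@alternating_values_eq0 _ _ (\row_i (nth 0%N s i)%:R)).
  move=> i j ij; rewrite !mxE ltr_nat; apply: (sorted_ltn_nth ltn_trans 0%N ltn_s) => //.
    by rewrite inE (leq_trans (ltn_ord i)).
  by rewrite inE (leq_trans (ltn_ord j)).
move=> i; rewrite mxE; have si : (i < size s)%N := leq_trans (ltn_ord i) ds.
have := nth_alternating alt (i := i); rewrite size_map (nth_map 0%N) // => /(_ si) /= odd_si.
have := allP as_ _ (mem_nth 0%N si).
by rewrite /= -leNgt -signr_odd odd_si signr_odd.
Qed.
End Gale.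

Section UpperBound.
Variables (d n m : nat).
Let R : realType := Rdefinitions.R.

Definition gale_cover (i : 'I_(d + n + m)) : set (pt d) :=
  if (i < d + 2 * n)%N
  then [set x | unit_sphere d x /\ 0 < (-1) ^+ i * eval_row (x : 'rV[R]_d.+1) i%:R]
  else north_hemi d.

Lemma open_positive (f : 'I_d.+1 -> R -> R) : (forall i, continuous (f i)) ->
  open [set x : 'rV[R]_d.+1 | 0 < \sum_i f i (x ord0 i)].
Proof.
move=> fc; apply: (@open_comp _ _ _ [set z : R | 0 < z]) => [x _|]; last exact: open_gt.
exact: continuous_row_sum.
Qed.

Lemma gale_cover_open i : open_in_sphere (gale_cover i).
Proof.
rewrite /gale_cover; case: ifP => _.
  exists [set x : 'rV[R]_d.+1 | 0 < \sum_(j < d.+1) (-1) ^+ i * i%:R ^+ j * x ord0 j]; split.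
    by apply: (open_positive (f := fun j z => (-1) ^+ i * i%:R ^+ j * z)) => j; exact: mulrl_continuous.
  apply/seteqP; split=> x; rewrite /= /eval_row mulr_sumr.
    move=> [sx x0]; split=> //; move: x0; congr (0 < _).
    by apply: eq_bigr => j _; ring.
  move=> [x0 sx]; split=> //; move: x0; congr (0 < _).
  by apply: eq_bigr => j _; ring.
exists [set x : 'rV[R]_d.+1 | 0 < x ord0 ord_max]; split.
  apply: (@open_comp _ _ _ [set z : R | 0 < z]) => [x _|]; last exact: open_gt.
  exact: coord_continuous.
by apply/seteqP; split=> x /=; rewrite /north_hemi /= inE => -[].
Qed.

Lemma gale_cover_antipodal i x : x \in gale_cover i -> - x \notin gale_cover i.
Proof.
rewrite inE => Fx; apply/negP; rewrite inE; move: Fx; rewrite /gale_cover.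
case: ifP => _ /= [_ x0] [_].
  suff -> : eval_row (- x : 'rV[R]_d.+1) i%:R = - eval_row (x : 'rV[R]_d.+1) i%:R.
    by rewrite mulrN oppr_gt0 ltNge ltW.
  by rewrite /eval_row -sumrN; apply: eq_bigr => j _; rewrite mxE mulNr.
by rewrite mxE oppr_gt0 ltNge ltW.
Qed.

(** One inequality yields both multiplicities: the hemispheres of Gale's lemma contribute n
    everywhere, and the m - n remaining sets contribute in the north. *)
Lemma gale_cover_mult x : x \in unit_sphere d -> (n <= m)%N ->
  (n + (x \in north_hemi d) * (m - n) <= mult gale_cover x)%N.
Proof.
rewrite inE => sx nm; set north := x \in _.
pose p i := 0 < (-1) ^+ i * eval_row (x : 'rV[R]_d.+1) i%:R.
pose f i : nat := if (i < d + 2 * n)%N then p i else north.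
have dn : (d + 2 * n <= d + n + m)%N by lia.
have -> : mult gale_cover x = (\sum_(0 <= i < d + n + m) f i)%N.
  rewrite multE -sum1_card big_mkcond big_mkord; apply: eq_bigr => i _.
  rewrite -[i \in _]/(`[< gale_cover i x >]) /f /gale_cover /north; case: ltnP => _.
    rewrite (_ : `[< _ >] = p i); first by case: (p i).
    by apply/asboolP/idP => [[]|] // pi; split.
  rewrite -[x \in _]/(`[< north_hemi d x >]).
  by case: `[< _ >].
rewrite (big_cat_nat (leq0n _) dn) /= leq_add //.
  apply: leq_trans (gale n (sphere_neq0 sx)) _; rewrite -sum1_count big_mkcond /=.
  rewrite [leqLHS](_ : _ = \sum_(0 <= i < d + 2 * n) f i)%N //.
  rewrite /index_iota subn0; apply: eq_big_seq => i.
  by rewrite mem_iota add0n /= /f => ->; rewrite -/(p i); case: (p i).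
rewrite [leqRHS](eq_big_nat _ _ (F2 := fun=> nat_of_bool north)).
  by rewrite sum_nat_const_nat mulnC leq_mul2r; apply/orP; right; lia.
by move=> i /andP[di _]; rewrite /f ltnNge di.
Qed.

Lemma gale_cover_nm : (n <= m)%N -> antipodal_nm_open_cover n m gale_cover.
Proof.
move=> nm; split=> [||x sx|x]; [exact: gale_cover_open|exact: gale_cover_antipodal| |].
  exact: leq_trans (leq_addr _ _) (gale_cover_mult sx nm).
move=> xn; have sx : x \in unit_sphere d by move: xn; rewrite inE => -[].
by have := gale_cover_mult sx nm; rewrite xn mul1n subnKC.
Qed.
End UpperBound.

Local Close Scope ring_scope.
Local Close Scope classical_set_scope.

(* f(d,n,m) = min number of sets; stated as: a cover with d+n+m sets exists
   (so the min exists and is <= d+n+m), and every such cover has at least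
   ceil((d-1)/2)+n+m sets. *)
Theorem theorem5 (d n m : nat) :
  (1 <= d)%N -> (1 <= n)%N -> (n < m)%N ->
  (exists F : 'I_(d + n + m) -> set (pt d), antipodal_nm_open_cover n m F) /\
  (forall (k : nat) (F : 'I_k -> set (pt d)),
      antipodal_nm_open_cover n m F -> ((d - 1).+1 %/ 2 + n + m <= k)%N).
Proof.
move=> d1 n1 nm; split.
  by exists (@gale_cover d n m); apply: gale_cover_nm; exact: ltnW.
(* The ceiling of (d-1)/2 equals d/2 rounded down. *)
move=> k F coverF; rewrite subn1 prednK // divn2.
exact: cover_lower_bound coverF d1 n1.
Qed.
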